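(* There is a constant $C>0$ such that for all integers $m, d \ge 2$ with $m \ge d$, the expected star discrepancy of a jittered sampling point set $P \subset [0,1)^d$ with $|P| = m^d$ points satisfies \[ \mathbb{E}\, D^*(P) \ \ge\ C \sqrt{d m^d}\, \sqrt{\frac{1+\log(m/d)}{m/d}} . \]
   Context: For an $N$-point set $P \subseteq [0,1)^d$ and a Lebesgue-measurable set $A$, let $\operatorname{disc}_P(A) := |P \cap A| - N\lambda(A)$, where $\lambda$ is the Lebesgue measure. The (non-normalized) star discrepancy of $P$ is $D^*(P) := \sup_{x \in [0,1)^d} |\operatorname{disc}_P([0,x))|$, where $[0,x) := \prod_{i=1}^d [0,x_i)$. Jittered sampling: for positive integers $m,d$, partition $[0,1)^d$ into the $m^d$ cubes ($m$-cubes) $\prod_{i=1}^d [q_i, q_i + \frac1m)$ with $q \in \{0,\frac1m,\dots,\frac{m-1}{m}\}^d$. A jittered sampling point set of $N=m^d$ points is the random set obtained by choosing, independently for each $m$-cube, one point uniformly at random in that cube. Here $\log$ is the natural logarithm (the base only affects the constant). *)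

(* Defs.v *)
From HB Require Import structures.
From mathcomp Require Export all_boot all_order all_algebra.
From mathcomp Require Export finmap.
From mathcomp Require Export all_classical all_reals all_analysis.

Export Order.TTheory GRing.Theory Num.Theory.
Export numFieldNormedType.Exports.

Set Implicit Arguments.
Unset Strict Implicit.
Unset Printing Implicit Defensive.

Local Open Scope classical_set_scope.
Local Open Scope ring_scope.

(* Points of R^d.  The sigma-algebra on tuples is generated by the coordinate
   projections, i.e., it is the Borel one. *)
Notation point R d := (d.-tuple (measurableTypeR R)).

(* The product measure is transported along R * R^n -> R^n.+1. *)
Fixpoint lebesgue_point (R : realType) (d : nat) : set (point R d) -> \bar R :=
  if d is n.+1 then
    pushforward (lebesgue_measure \x lebesgue_point (R := R) (d := n))%E
      (fun p : measurableTypeR R * point R n =>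
         [tuple of p.1 :: p.2] : point R n.+1)
  else dirac ([tuple] : point R 0).

Section StarDiscrepancy.
Context {R : realType} {d : nat}.
Implicit Types (P A : set (point R d)) (x : point R d).

(* The set P is meant to be finite (fset_set P is empty otherwise). *)
Definition disc P A : R :=
  #|` fset_set (P `&` A)|%:R - #|` fset_set P|%:R * fine (lebesgue_point A).

Definition unit_cube : set (point R d) :=
  [set x | forall i, tnth x i \in `[0, 1[].

Definition anchored_box x : set (point R d) :=
  [set y | forall i, tnth y i \in `[0, tnth x i[].

Definition star_discrepancy P : R :=
  sup [set `|disc P (anchored_box x)| | x in unit_cube].

End StarDiscrepancy.

(* Index k stands for the corner q = (k_1/m, ..., k_d/m). *)
Definition mcube {R : realType} {m d : nat} (k : {ffun 'I_d -> 'I_m}) :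
    set (point R d) :=
  [set y | forall i, tnth y i \in `[(k i)%:R / m%:R, (k i)%:R / m%:R + m%:R^-1[].

Section JitteredSampling.
Context {R : realType} {disp : measure_display} {T : measurableType disp}.
Variable Pr : probability T R.

Definition mutually_independent (I : finType) (d : nat)
    (X : I -> {RV Pr >-> point R d}) : Prop :=
  forall (J : {set I}) (A : I -> set (point R d)),
    (forall k, measurable (A k)) ->
    (Pr (\bigcap_(k in [set` J]) (X k @^-1` A k)) =
     \prod_(k in J) Pr (X k @^-1` A k))%E.

Definition uniform_on (d : nat) (Y : {RV Pr >-> point R d})
    (Q : set (point R d)) : Prop :=
  forall A, measurable A ->
    distribution Pr Y A = (lebesgue_point (A `&` Q) / lebesgue_point Q)%E.

(* X k is the point chosen in the cube mcube k.  It lies in this cube almost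
   surely, which does not affect expectations. *)
Definition jittered_sampling (m d : nat)
    (X : {ffun 'I_d -> 'I_m} -> {RV Pr >-> point R d}) : Prop :=
  mutually_independent X /\ forall k, uniform_on (X k) (mcube k).

Definition sample_set (m d : nat)
    (X : {ffun 'I_d -> 'I_m} -> {RV Pr >-> point R d}) (w : T) :
    set (point R d) :=
  range (fun k => X k w).

End JitteredSampling.

(* Main.v *)
Require Import Defs.
From mathcomp Require Import ring lra zify measurable_realfun.

(** The lower bound comes from one box per sample, chosen by looking at part of
    the sample only.

    Halve every cell in every direction.  The halves that contain the sampled
    points are independent fair bits, one per cell and direction, so for boxes
    whose sides are multiples of [1 / (2 m)] the discrepancy is a function of
    these bits, and its mean is an average over a finite set of configurations
    (lemma [expectation_star_discrepancy_ge]).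

    In each direction let [L], about [m / d], layers of cells be candidates: the
    ones with largest coordinate.  A box side that ends in the middle of a layer
    cuts each cell of that layer in half.  Those cells of the layer that lie
    below all candidate layers in the other directions are cut in this direction
    only, whatever the other sides are, and contribute half of a sum of random
    signs.  There are [(m - L) ^ (d - 1)] of them, which is at least
    [m ^ (d - 1) / 4], and the cells attached to different directions or layers
    are disjoint.  In every direction the box ends in a layer whose sign sum is
    exceptionally large, and just below all candidates if there is none.  The
    remaining cells are independent of this choice, so their contribution has
    mean zero ([avg_excess_off_core]).

    It remains to find large sign sums among [L] independent ones with [n]
    terms.  Cut the terms into [t] blocks.  By the second and fourth moments
    each block exceeds a multiple of [sqrt (n / t)] with probability at least
    1/10 ([sign_sum_tail]), hence all [t] do with probability at least
    [10 ^- t].  With [10 ^ t] of the order of [L], some layer passes the sum of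
    the thresholds, of order [sqrt (n t)], with probability at least 1/11
    ([avg_chosen_layer]).  Since [t] has the order of [1 + log (m / d)], adding
    up the [d] directions gives the bound ([jittered_bits_bound]). *)

Set Implicit Arguments.
Unset Strict Implicit.
Unset Printing Implicit Defensive.

Local Open Scope ring_scope.

(** * Averages over independent fair bits *)

Section UniformBits.
Context {R : rcfType} {I : finType}.
Implicit Types (A B : {set I}) (f g : {ffun I -> bool} -> R).

Definition avg f : R := (\sum_b f b) / 2 ^+ #|I|.

(** The coordinates that a function reads: functions that read disjoint sets of
    coordinates are independent. *)
Definition local_to (X : Type) A (f : {ffun I -> bool} -> X) :=
  forall b c : {ffun I -> bool}, {in A, b =1 c} -> f b = f c.

Definition splice A (b c : {ffun I -> bool}) : {ffun I -> bool} :=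
  [ffun i => if i \in A then b i else c i].

Lemma eq_avg f g : f =1 g -> avg f = avg g.
Proof. by move=> fg; rewrite /avg; under eq_bigr do rewrite fg. Qed.

Lemma avgD f g : avg (fun b => f b + g b) = avg f + avg g.
Proof. by rewrite /avg big_split mulrDl. Qed.

Lemma avgZ (a : R) f : avg (fun b => a * f b) = a * avg f.
Proof. by rewrite /avg -mulr_sumr mulrA. Qed.

Lemma avg_cst (a : R) : avg (fun=> a) = a.
Proof.
rewrite /avg sumr_const card_ffun card_bool -(mulr_natr a) natrX mulfK//.
Qed.

Lemma avg_sum (J : Type) (r : seq J) (P : pred J) (F : J -> _ -> R) :
  avg (fun b => \sum_(j <- r | P j) F j b) = \sum_(j <- r | P j) avg (F j).
Proof. by rewrite /avg exchange_big mulr_suml. Qed.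

Lemma ler_avg f g : (forall b, f b <= g b) -> avg f <= avg g.
Proof.
by move=> fg; rewrite ler_pM2r ?ler_sum// => *; rewrite invr_gt0 exprn_gt0.
Qed.

Lemma avg_ge0 f : (forall b, 0 <= f b) -> 0 <= avg f.
Proof. by move=> f0; rewrite -[0]avg_cst ler_avg. Qed.

(** Exchanging the coordinates outside [A] between two independent
    configurations is an involution that preserves the uniform law on pairs. *)
Lemma avg_decouple A (F : {ffun I -> bool} -> {ffun I -> bool} -> R) :
  (forall c, local_to A (F^~ c)) -> (forall b, local_to (~: A) (F b)) ->
  avg (fun b => F b b) = avg (fun b => avg (F b)).
Proof.
move=> FA FcA; pose h p := (splice A p.1 p.2, splice A p.2 p.1).
have hK : involutive h.
  by case=> b c; congr (_, _); apply/ffunP => i; rewrite !ffunE/=;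
    case: ifP => iA; rewrite ?ffunE iA.
transitivity (avg (fun b => avg (fun=> F b b))).
  by apply: eq_avg => b; rewrite avg_cst.
rewrite /avg -!mulr_suml; congr (_ / _ / _).
rewrite !pair_bigA/= [RHS](reindex_inj (inv_inj hK))/=.
rewrite [LHS](reindex_inj (inv_inj hK))/=.
rewrite [RHS](reindex_inj (inv_inj hK))/=.
apply: eq_bigr => -[b c] _ /=.
have -> : splice A (splice A b c) (splice A c b) = b.
  by apply/ffunP => i; rewrite !ffunE; case: ifP => iA; rewrite ?ffunE ?iA.
have -> : splice A (splice A c b) (splice A b c) = c.
  by apply/ffunP => i; rewrite !ffunE; case: ifP => iA; rewrite ?ffunE ?iA.
rewrite (FA _ _ b) => [|i iA]; last by rewrite ffunE iA.
by apply: FcA => i; rewrite inE => /negbTE iA; rewrite ffunE iA.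
Qed.

Lemma avgM A B f g : [disjoint A & B] -> local_to A f -> local_to B g ->
  avg (fun b => f b * g b) = avg f * avg g.
Proof.
move=> dAB fA gB; rewrite (@avg_decouple A (fun b c => f b * g c)).
- under eq_avg do rewrite avgZ mulrC.
  by rewrite avgZ mulrC.
- by move=> c b b' /fA ->.
- move=> b c c' cc'; congr (_ * _); apply: gB => i iB; apply: cc'.
  by rewrite inE (disjointFl dAB).
Qed.

Lemma avg_prod (J : finType) (A : J -> {set I}) (f : J -> _ -> R) :
  (forall i j, i != j -> [disjoint A i & A j]) ->
  (forall j, local_to (A j) (f j)) ->
  avg (fun b => \prod_j f j b) = \prod_j avg (f j).
Proof.
move=> dA fA; rewrite -big_enum/=.
under eq_avg do rewrite -big_enum/=.
have := enum_uniq J; elim: (enum J) => [|j r IH]/=.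
  by rewrite big_nil; under eq_avg do rewrite big_nil; rewrite avg_cst.
move=> /andP[jr ur]; rewrite big_cons -IH//.
under eq_avg do rewrite big_cons.
apply: (@avgM (A j) (\bigcup_(k <- r) A k)%SET) => //.
  rewrite finset.bigcup_seq; apply/bigcup_disjointP => k kr; apply: dA.
  by apply: contraNneq jr => ->.
move=> b c bc; rewrite !big_seq; apply: eq_bigr => k kr; apply: fA => i iA.
by apply: bc; rewrite finset.bigcup_seq; apply/bigcupP; exists k.
Qed.

(** Flipping one bit preserves the uniform law, so each value of the bit can be
    averaged with the opposite one. *)
Lemma avg_bit (h : bool -> R) i :
  avg (fun b => h (b i)) = (h true + h false) / 2.
Proof.
pose flip (b : {ffun I -> bool}) := [ffun j => b j (+) (j == i)].
have flipK : involutive flip.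
  by move=> b; apply/ffunP => j; rewrite !ffunE addbK.
apply: (@mulIf _ 2) => //; rewrite divfK ?pnatr_eq0//.
rewrite -[RHS]avg_cst mulr_natr mulr2n.
rewrite -{1}[avg _](_ : avg (fun b => h (flip b i)) = _); last first.
  by rewrite /avg [in RHS](reindex_inj (inv_inj flipK)).
rewrite -avgD; apply: eq_avg => b.
by rewrite ffunE eqxx addbT; case: (b i); rewrite //= addrC.
Qed.

(** * Sums of random signs *)

Definition sign (x : bool) : R := if x then 1 else -1.

Definition sign_sum A (b : {ffun I -> bool}) : R := \sum_(i in A) sign (b i).

Lemma sign_sum_local A : local_to A (sign_sum A).
Proof. by move=> b c bc; apply: eq_bigr => i /bc ->. Qed.

Lemma avg_sign_sumN A (f : R -> R) :
  avg (fun b => f (- sign_sum A b)) = avg (fun b => f (sign_sum A b)).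
Proof.
pose neg (b : {ffun I -> bool}) := [ffun j => ~~ b j].
have negK : involutive neg by move=> b; apply/ffunP => j; rewrite !ffunE negbK.
rewrite /avg [in RHS](reindex_inj (inv_inj negK)); congr (_ / _).
apply: eq_bigr => b _; congr (f _); rewrite /sign_sum -sumrN.
apply: eq_bigr => i _; rewrite ffunE /sign.
by case: (b i) => //=; rewrite opprK.
Qed.

Lemma avg_sign_sum_moments A :
  avg (fun b => sign_sum A b ^+ 2) = #|A|%:R /\
  avg (fun b => sign_sum A b ^+ 4) <= 3 * #|A|%:R ^+ 2.
Proof.
(* Adding a sign to a sum S of n others: odd powers of the sign have mean zero,
   so the moments become E S^2 + 1 and E S^4 + 6 n + 1. *)
have [n] := ubnP #|A|; elim: n A => // n IH A.
have [->|/set0Pn[i iA]] := eqVneq A finset.set0.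
  move=> _; rewrite cards0 /sign_sum.
  under eq_avg do rewrite big_set0 expr0n.
  rewrite avg_cst; split => //.
  under eq_avg do rewrite big_set0 expr0n.
  by rewrite avg_cst expr0n mulr0.
rewrite (cardsD1 i A) iA add1n ltnS => /IH; set A' := A :\ i.
case=> m2 m4.
pose e (b : {ffun I -> bool}) := sign (b i).
have SE b : sign_sum A b = e b + sign_sum A' b.
  by rewrite /sign_sum (bigD1 i)//=; congr (_ + _); apply: eq_bigl => j;
    rewrite !inE andbC.
have e2 b : e b ^+ 2 = 1 by rewrite /e /sign; case: ifP; rewrite ?sqrrN expr1n.
have eM k : avg (fun b => e b * sign_sum A' b ^+ k) = 0.
  rewrite (@avgM [set i]%SET A').
  - by rewrite /e avg_bit /sign subrr mul0r mul0r.
  - by rewrite disjoints1 !inE eqxx.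
  - by move=> b c bc; rewrite /e bc ?inE.
  - by move=> b c bc; rewrite (sign_sum_local bc).
split.
  rewrite (@eq_avg _ (fun b => 1 + (2 * (e b * sign_sum A' b ^+ 1) +
      sign_sum A' b ^+ 2))) => [|b].
    by rewrite !avgD avgZ eM m2 avg_cst mulr0 add0r -natr1 addrC.
  by rewrite SE sqrrD e2; ring.
rewrite (@eq_avg _ (fun b => 1 + (4 * (e b * sign_sum A' b ^+ 1) +
   (6 * sign_sum A' b ^+ 2 + (4 * (e b * sign_sum A' b ^+ 3) +
     sign_sum A' b ^+ 4))))) => [|b].
  rewrite !avgD !avgZ !eM m2 avg_cst !mulr0 !add0r -natr1.
  have : (0 : R) <= #|A'|%:R by [].
  by move: m4; nra.
rewrite SE; have := e2 b; set x := e b; set y := sign_sum A' b => x2.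
have -> : (x + y) ^+ 4 =
  x ^+ 2 * x ^+ 2 + (4 * x ^+ 2 * (x * y) + (6 * x ^+ 2 * y ^+ 2 +
  (4 * (x * y ^+ 3) + y ^+ 4))) by ring.
by rewrite x2; ring.
Qed.

(** Paley-Zygmund.  The parabola [(u - 1/4) (7 - u)] in the normalised square
    [u] is nonpositive for [u < 1/4] and at most [729/64] everywhere, so its
    mean, at least [5/2] because [u] has mean 1 and second moment at most 3,
    bounds the probability of [u >= 1/4] from below. *)
Lemma sign_sum_tail A :
  10^-1 <= avg (fun b => (Num.sqrt #|A|%:R / 2 <= sign_sum A b)%R%:R).
Proof.
have [->|A0] := eqVneq A finset.set0.
  rewrite (@eq_avg _ (fun=> 1)) ?avg_cst ?invf_le1//; first lra.
  by move=> b; rewrite cards0 sqrtr0 mul0r /sign_sum big_set0 lexx.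
have n0 : 0 < #|A|%:R :> R by rewrite ltr0n card_gt0.
have := avg_sign_sum_moments A; set n := #|A|%:R in n0 * => -[m2 m4].
set P := avg _.
(* By symmetry both tails have the same probability. *)
have -> : P = (P + avg (fun b => (Num.sqrt n / 2 <= - sign_sum A b)%R%:R)) / 2.
  rewrite (@avg_sign_sumN A (fun s => (Num.sqrt n / 2 <= s)%R%:R)) -/P.
  by rewrite -[P in LHS]mulr1; field.
rewrite -avgD.
(* The parabola, expanded for the computation of its mean. *)
pose q s : R :=
  64 / 729 * (29 / 4 / n * s ^+ 2 + (- (n ^- 2) * s ^+ 4 - 7 / 4)).
have : avg (fun b => q (sign_sum A b)) >= 5^-1.
  rewrite avgZ !avgD !avgZ avg_cst m2 divfK ?gt_eqF//.
  have : n ^- 2 * avg (fun b => sign_sum A b ^+ 4) <= 3.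
    by rewrite mulrC ler_pdivrMr// exprn_gt0.
  by rewrite mulNr; lra.
move=> /le_trans Hq; suff : avg (fun b => q (sign_sum A b)) <= avg
    (fun b => (Num.sqrt n / 2 <= sign_sum A b)%R%:R +
              (Num.sqrt n / 2 <= - sign_sum A b)%R%:R).
  by move=> /Hq; lra.
apply: ler_avg => b; set s := sign_sum A b.
have -> : q s = 64 / 729 * ((s ^+ 2 / n - 4^-1) * (7 - s ^+ 2 / n)).
  by rewrite /q; field; rewrite gt_eqF.
set u := s ^+ 2 / n.
have qle1 : 64 / 729 * ((u - 4^-1) * (7 - u)) <= 1.
  have := sqr_ge0 (u - 29 / 8); rewrite expr2; lra.
have [lt|ge] := leP (Num.sqrt n / 2) `|s|.
  have [s0|s0] := leP 0 s.
    rewrite ger0_norm// in lt; rewrite lt.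
    by rewrite (le_trans qle1)// lerDl.
  rewrite ltr0_norm// in lt; rewrite lt.
  by rewrite (le_trans qle1)// lerDr.
rewrite (_ : (_ <= s) = false); last first.
  by apply/negbTE; rewrite -ltNge (le_lt_trans (ler_norm _) ge).
rewrite (_ : (_ <= - s) = false); last first.
  by apply/negbTE; rewrite -ltNge (le_lt_trans _ ge)// -normrN ler_norm.
have u4 : u < 4^-1.
  rewrite ltr_pdivrMr// -real_normK ?num_real//.
  have -> : 4^-1 * n = (Num.sqrt n / 2) ^+ 2.
    by rewrite exprMn sqr_sqrtr ?ltW//; field.
  by rewrite ltr_pXn2r ?nnegrE ?divr_ge0 ?sqrtr_ge0.
have : (4^-1 - u) * (7 - u) >= 0 by rewrite mulr_ge0; lra.
by rewrite [false%:R](_ : _ = 0)//; lra.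
Qed.

End UniformBits.
(** * Elementary inequalities *)

Lemma bernoulli_ineq (R : realDomainType) (x : R) n :
  -1 <= x -> 1 + n%:R * x <= (1 + x) ^+ n.
Proof.
move=> x1; elim: n => [|n IH]; first by rewrite mul0r addr0.
rewrite exprS; apply: (@le_trans _ _ ((1 + x) * (1 + n%:R * x))); last first.
  by rewrite ler_wpM2l//; lra.
rewrite -natr1.
have : 0 <= n%:R * (x * x) by rewrite mulr_ge0// -expr2 sqr_ge0.
lra.
Qed.

(** For the exponent [k] Bernoulli's inequality gives only [1 / (k + 1)], but
    for half of it [1 / 2], which is then squared. *)
Lemma one_sub_inv_expr_ge (R : realFieldType) k :
  4^-1 <= (1 - k.+1%:R^-1) ^+ k :> R.
Proof.
have k0 : 0 < k.+1%:R :> R by rewrite ltr0n.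
have x1 : k.+1%:R^-1 <= 1 :> R by rewrite invf_le1// ler1n.
have x0 : 0 <= 1 - k.+1%:R^-1 :> R by rewrite subr_ge0.
apply: (@le_trans _ _ ((1 - k.+1%:R^-1) ^+ (uphalf k + uphalf k))); last first.
  by apply: ler_wiXn2l => //; lia.
have : 2^-1 <= (1 - k.+1%:R^-1) ^+ uphalf k :> R.
  have := @bernoulli_ineq R (- k.+1%:R^-1) (uphalf k).
  rewrite lerN2 => /(_ x1); apply: le_trans.
  have : (uphalf k)%:R * k.+1%:R^-1 <= 2^-1 :> R.
    rewrite ler_pdivrMr// mulrC ler_pdivlMr// -natrM ler_nat; lia.
  by rewrite mulrN; move: (_ / _) => y; lra.
by rewrite exprD => h; nra.
Qed.

(** * Discrepancy of half-cell boxes as a function of random bits *)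

Section HalfCellBoxes.
Context {R : rcfType} {m d : nat}.
Local Notation cell := {ffun 'I_d -> 'I_m}.
Local Notation bits := {ffun cell * 'I_d -> bool}.
Implicit Types (b : bits) (q : cell) (c : 'I_d -> nat).

(** The bit of [(q, i)] is true when the point of the cell [q] lies in the lower
    half of the cell in direction [i], i.e., when its [i]-th coordinate lies in
    the half-cell number [2 * q i] rather than [2 * q i + 1].  The box has side
    [c i] in direction [i], counted in half-cells. *)
Definition in_box b q c : bool :=
  [forall i, 2 * q i + ~~ b (q, i) < c i]%N.

(** The subtracted product is the number of cells times the volume of the box:
    [m ^ d] times the product of the [c i / (2 m)]. *)
Definition bit_disc b c : R :=
  \sum_q (in_box b q c)%:R - \prod_i ((c i)%:R / 2).

(** The probability that a uniform point of the cell number [a] of a line lies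
    below the half-cell number [v]. *)
Definition half_cells (a v : nat) : R :=
  ((2 * a < v)%N%:R + (2 * a + 1 < v)%N%:R) / 2.

Lemma half_cells_below a v : (2 * a + 1 < v)%N -> half_cells a v = 1.
Proof.
move=> av; rewrite /half_cells av (leq_ltn_trans _ av) ?leq_addr//.
by rewrite -natrD divff ?pnatr_eq0.
Qed.

Lemma whole_cell_excess a v (x : bool) :
  (2 * a + ~~ x < 2 * v)%N%:R - half_cells a (2 * v) = 0.
Proof.
rewrite /half_cells.
have -> : (2 * a + ~~ x < 2 * v)%N = (a < v)%N by case: x; lia.
have -> : (2 * a < 2 * v)%N = (a < v)%N by lia.
have -> : (2 * a + 1 < 2 * v)%N = (a < v)%N by lia.
by case: (a < v)%N; rewrite /=; lra.
Qed.

(** A side that ends in the middle of a cell turns the bit of this cell into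
    half a random sign; every other cell is decided by its position. *)
Lemma half_cell_excess a v (x : bool) :
  (2 * a + ~~ x < 2 * v + 1)%N%:R - half_cells a (2 * v + 1) =
  (v == a)%N%:R * (sign x / 2).
Proof.
rewrite /half_cells /sign.
have -> : (2 * a + ~~ x < 2 * v + 1)%N = (a < v)%N || ((v == a) && x).
  by case: x; lia.
have -> : (2 * a < 2 * v + 1)%N = (a < v)%N || (v == a) by lia.
have -> : (2 * a + 1 < 2 * v + 1)%N = (a < v)%N by lia.
by case: (ltngtP a v); case: x; rewrite /=; lra.
Qed.

Lemma sum_half_cells v : (v <= 2 * m)%N ->
  \sum_(a < m) half_cells a v = v%:R / 2.
Proof.
move=> vm; rewrite -mulr_suml; congr (_ / _).
suff -> : \sum_(a < m) ((2 * a < v)%N%:R + (2 * a + 1 < v)%N%:R) =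
    (minn v (2 * m))%:R :> R by rewrite (minn_idPl vm).
elim: m => [|k IH]; first by rewrite big_ord0 muln0 minn0.
by rewrite big_ord_recr/= IH -!natrD; congr _%:R; lia.
Qed.

Lemma box_volumeE c : (forall i, c i <= 2 * m)%N ->
  \prod_i ((c i)%:R / 2) = \sum_(q : cell) \prod_i half_cells (q i) (c i).
Proof.
move=> cm.
rewrite -(bigA_distr_bigA (fun i (a : 'I_m) => half_cells a (c i))).
by apply: eq_bigr => i _; rewrite sum_half_cells.
Qed.

Lemma in_boxE b q c :
  (in_box b q c)%:R = \prod_i (2 * q i + ~~ b (q, i) < c i)%N%:R :> R.
Proof.
rewrite /in_box; case: forallP => [h|/forallP].
  by rewrite big1// => i _; rewrite h.
by rewrite negb_forall => /existsP[i /negbTE h]; rewrite (bigD1 i)//= h mul0r.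
Qed.

Lemma avg_in_box q c :
  avg (fun b => (in_box b q c)%:R) = \prod_i half_cells (q i) (c i).
Proof.
under eq_avg do rewrite in_boxE.
rewrite (@avg_prod _ _ _ (fun i => [set (q, i)]%SET)
  (fun i b => (2 * q i + ~~ b (q, i) < c i)%N%:R)).
- apply: eq_bigr => i _.
  rewrite (avg_bit (fun x : bool => (2 * q i + ~~ x < c i)%N%:R)).
  by rewrite /= addn0.
- by move=> i j ij; rewrite disjoints1 inE; apply: contra ij => /eqP[->].
- by move=> i b b' bb'; rewrite bb'// inE.
Qed.

End HalfCellBoxes.

(** * The box chosen from the sample *)

(** Candidate layers have coordinates [M + l] with [l < L], where [M + L = m].
    [B i l j] is the [j]-th of the [t] blocks, of [s] cells each, that decide
    whether the layer [l] of direction [i] is used. *)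
Section GreedyBox.
Context {R : rcfType} {m d L t : nat}.
Local Notation cell := {ffun 'I_d -> 'I_m}.
Local Notation bits := {ffun cell * 'I_d -> bool}.
Variables (M s : nat) (B : 'I_d -> 'I_L -> 'I_t -> {set cell}).
Implicit Types (b : bits) (q : cell) (i : 'I_d) (l : 'I_L) (j : 'I_t).

Definition dir_bits i (A : {set cell}) : {set cell * 'I_d} :=
  [set x | (x.1 \in A) && (x.2 == i)].

Definition good_layer i l b : bool :=
  [forall j, Num.sqrt s%:R / 2 <= sign_sum (dir_bits i (B i l j)) b :> R].

Definition chosen_layer i b : option 'I_L := [pick l | good_layer i l b].

(** With no good layer the side stops at the bottom of the candidates and cuts
    no cell. *)
Definition greedy_corner b i : nat :=
  if chosen_layer i b is Some l then (2 * (M + l) + 1)%N else (2 * M)%N.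

Hypothesis MLm : (M + L = m)%N.
Hypothesis B_layer : forall i l j q, q \in B i l j ->
  q i = (M + l)%N :> nat /\ forall i', i' != i -> (q i' < M)%N.
Hypothesis card_B : forall i l j, #|B i l j| = s.
Hypothesis B_disj : forall i l j j', j != j' -> [disjoint B i l j & B i l j'].

Lemma greedy_corner_ge b i : (2 * M <= greedy_corner b i)%N.
Proof. by rewrite /greedy_corner; case: chosen_layer => [l|] //; lia. Qed.

Lemma greedy_corner_lt b i : (0 < L)%N -> (greedy_corner b i < 2 * m)%N.
Proof.
rewrite /greedy_corner; case: chosen_layer => [l|]; last lia.
by have := ltn_ord l; lia.
Qed.

Lemma card_dir_bits i A : #|dir_bits i A| = #|A|.
Proof.
have -> : dir_bits i A = [set (q, i) | q in A]%SET.
  apply/setP => -[q i']; rewrite inE/=; apply/andP/imsetP => [[qA /eqP->]|].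
    by exists q.
  by case=> q' q'A [-> ->].
by rewrite card_imset// => q q' [].
Qed.

Lemma sign_sum_dir_bits i A b :
  sign_sum (dir_bits i A) b = \sum_(q in A) sign (b (q, i)) :> R.
Proof.
rewrite /sign_sum (reindex_onto (fun q => (q, i)) (fun x => x.1)) => [|x].
  by apply: eq_bigl => q; rewrite inE/= !eqxx !andbT.
by rewrite inE => /andP[_ /eqP <-]; case: x.
Qed.

Lemma avg_good_layer i l :
  10^-1 ^+ t <= avg (fun b => (good_layer i l b)%:R) :> R.
Proof.
have indE b : (good_layer i l b)%:R = \prod_j
    ((Num.sqrt s%:R / 2 <= sign_sum (dir_bits i (B i l j)) b :> R)%R%:R) :> R.
  rewrite /good_layer; case: forallP => [h|/forallP].
    by rewrite big1// => j _; rewrite h.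
  by rewrite negb_forall => /existsP[j /negbTE h]; rewrite (bigD1 j)//= h mul0r.
under eq_avg do rewrite indE.
rewrite (@avg_prod _ _ _ (fun j => dir_bits i (B i l j)) (fun j b =>
    (Num.sqrt s%:R / 2 <= sign_sum (dir_bits i (B i l j)) b :> R)%R%:R)).
- rewrite -[X in _ ^+ X]card_ord -prodr_const; apply: ler_prod => j _.
  rewrite invr_ge0 ler0n/= (le_trans (sign_sum_tail (dir_bits i (B i l j))))//.
  by rewrite card_dir_bits card_B.
- move=> j j' jj'; apply/pred0P => -[q i']/=; rewrite !inE/=.
  apply/negP => /andP[/andP[qj _] /andP[qj' _]].
  by have /pred0P/(_ q)/= := B_disj i l jj'; rewrite qj qj'.
- by move=> j b b' bb'; rewrite (sign_sum_local bb').
Qed.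

Lemma good_layer_local i l :
  local_to (dir_bits i (\bigcup_j B i l j)%SET) (good_layer i l).
Proof.
move=> b b' bb'; apply: eq_forallb => j; congr (_ <= _).
apply: sign_sum_local => x; rewrite inE => /andP[xB xi]; apply: bb'.
by rewrite inE xi andbT; apply/bigcupP; exists j.
Qed.

(** The layers are independent and each is good with probability at least
    [x = 1 / (10 L)], so none is good with probability at most [(1 - x) ^ L],
    which is at most [1 / (1 + x) ^ L <= 1 / (1 + L x) = 10 / 11]. *)
Lemma avg_chosen_layer i : (0 < L)%N -> (10 ^ t <= 10 * L)%N ->
  11^-1 <= avg (fun b => (chosen_layer i b != None)%:R) :> R.
Proof.
move=> L0 tL.
have indE b : (chosen_layer i b != None)%:R =
    1 - \prod_l (1 - (good_layer i l b)%:R) :> R.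
  rewrite /chosen_layer; case: pickP => [l gl|ng].
    by rewrite (bigD1 l)//= gl subrr mul0r subr0.
  by rewrite big1 ?subrr// => l _; rewrite ng subr0.
under eq_avg do rewrite indE -[- _]mulN1r.
rewrite avgD avg_cst avgZ.
rewrite (@avg_prod _ _ _ (fun l => dir_bits i (\bigcup_j B i l j)%SET)
  (fun l b => 1 - (good_layer i l b)%:R)); first last.
- by move=> l b b' bb'; rewrite (good_layer_local bb').
- move=> l l' ll'; apply/pred0P => -[q i']/=; rewrite !inE/=.
  apply/negP => /andP[/andP[/bigcupP[j _ qj] _] /andP[/bigcupP[j' _ qj'] _]].
  have [+ _] := B_layer qj; have [-> _] := B_layer qj'.
  by move=> /addnI/val_inj/esym/eqP; apply/negP.
pose x : R := (10 * L%:R)^-1.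
have L0' : 0 < L%:R :> R by rewrite ltr0n.
have x0 : 0 < x by rewrite invr_gt0 mulr_gt0.
have x1 : x <= 1 by rewrite invf_le1 ?mulr_gt0// -(natrM _ 10) ler1n muln_gt0.
have : \prod_l avg (fun b => 1 - (good_layer i l b)%:R) <= (1 - x) ^+ L.
  rewrite -[X in _ ^+ X]card_ord -prodr_const; apply: ler_prod => l _.
  apply/andP; split.
    by apply: avg_ge0 => b; rewrite subr_ge0 lern1 leq_b1.
  under eq_avg do rewrite -[- _]mulN1r.
  rewrite avgD avg_cst avgZ mulN1r lerD2l lerN2.
  apply: le_trans (avg_good_layer i l); rewrite exprVn /x lef_pV2 ?posrE//.
  - by rewrite -natrX -(natrM _ 10) ler_nat.
  - by rewrite mulr_gt0.
have : (1 - x) ^+ L * (11 / 10) <= 1.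
  have bern : 11 / 10 <= (1 + x) ^+ L.
    apply: (@le_trans _ _ (1 + L%:R * x)); last by apply: bernoulli_ineq; lra.
    by rewrite /x invfM mulrCA divff ?gt_eqF//; lra.
  apply: (@le_trans _ _ ((1 - x) ^+ L * (1 + x) ^+ L)).
    by rewrite ler_wpM2l// exprn_ge0 ?subr_ge0.
  have xx : (1 - x) * (1 + x) <= 1.
    by rewrite -subr_sqr expr1n gerBl sqr_ge0.
  by rewrite -exprMn exprn_ile1// mulr_ge0 ?subr_ge0// addr_ge0 ?ltW.
rewrite mulN1r; lra.
Qed.

Definition core : {set cell} :=
  (\bigcup_(k : 'I_d * 'I_L * 'I_t) B k.1.1 k.1.2 k.2)%SET.

Definition box_excess b q c : R :=
  (in_box b q c)%:R - \prod_i half_cells (q i) (c i).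

Lemma bit_disc_excess b : (0 < L)%N ->
  bit_disc b (greedy_corner b) = \sum_q box_excess b q (greedy_corner b).
Proof.
move=> L0; rewrite /bit_disc (@box_volumeE _ m) -?sumrB// => i.
by rewrite ltnW// greedy_corner_lt.
Qed.

Lemma greedy_corner_local b b' : {in [set x | x.1 \in core]%SET, b =1 b'} ->
  greedy_corner b =1 greedy_corner b'.
Proof.
move=> bb' i; rewrite /greedy_corner /chosen_layer.
suff /eq_pick -> : good_layer i ^~ b =1 good_layer i ^~ b' by [].
move=> l; apply: good_layer_local => -[q i']; rewrite inE/= => /andP[].
move=> /bigcupP[j _ qj] _; apply: bb'; rewrite inE/=.
by apply/bigcupP; exists (i, l, j).
Qed.

(** The corner reads only bits of core cells; for any fixed corner the
    contribution of a cell has mean zero. *)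
Lemma avg_excess_off_core q : q \notin core ->
  avg (fun b => box_excess b q (greedy_corner b)) = 0.
Proof.
move=> qU.
rewrite (@avg_decouple _ _ [set x | x.1 \in core]%SET
  (fun b b' => box_excess b' q (greedy_corner b))).
- rewrite (@eq_avg _ _ _ (fun=> 0)) ?avg_cst// => b.
  rewrite /box_excess; under eq_avg do rewrite -mulN1r.
  by rewrite avgD avg_cst avg_in_box mulN1r subrr.
- move=> b' b c /greedy_corner_local bc; rewrite /box_excess; congr (_ - _).
    by congr (nat_of_bool _)%:R; apply: eq_forallb => i; rewrite bc.
  by apply: eq_bigr => i _; rewrite bc.
- move=> b b' c bc; rewrite /box_excess; congr ((nat_of_bool _)%:R - _).
  by apply: eq_forallb => i; rewrite bc// !inE.
Qed.

(** In the other directions the cell lies below every candidate layer, hence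
    inside the box whatever corner was chosen. *)
Lemma excess_on_core b i l j q : q \in B i l j ->
  box_excess b q (greedy_corner b) =
  (chosen_layer i b == Some l)%:R * (sign (b (q, i)) / 2).
Proof.
move=> /B_layer[qi qi'].
have below i' : i' != i -> (2 * q i' + 1 < greedy_corner b i')%N.
  by move=> /qi'; have := greedy_corner_ge b i'; lia.
have sidesE (F : 'I_d -> R) : (forall i', i' != i -> F i' = 1) ->
    \prod_i' F i' = F i.
  by move=> F1; rewrite (bigD1 i)//= big1 ?mulr1.
rewrite /box_excess in_boxE !sidesE => [|i' /below|i' /below h].
- rewrite qi /half_cells /greedy_corner.
  case: (chosen_layer i b) => [l'|]; last by rewrite whole_cell_excess mul0r.
  by rewrite half_cell_excess eqn_add2l.
- exact: half_cells_below.
- suff -> : (2 * q i' + ~~ b (q, i') < greedy_corner b i')%N by [].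
  by apply: leq_ltn_trans h; rewrite leq_add2l leq_b1.
Qed.

(** In a good layer each of the [t] blocks contributes half of its sign sum,
    and this sum is at least [sqrt s / 2]. *)
Lemma sum_excess_on_core b :
  \sum_(q in core) box_excess b q (greedy_corner b) >=
  \sum_i (chosen_layer i b != None)%:R * (t%:R * Num.sqrt s%:R / 4).
Proof.
rewrite /core finset.partition_disjoint_bigcup; last first.
  (* A cell of a block has a candidate coordinate exactly in the direction of
     the block, so the block can be read off the cell. *)
  move=> [[i l] j] [[i' l'] j'] ne; apply/pred0P => q/=; apply/negP.
  move=> /andP[qB qB'].
  have [qi qlt] := B_layer qB; have [qi' qlt'] := B_layer qB'.
  have ii' : i = i'.
    by apply/eqP; apply: contraT => /qlt'; rewrite qi; lia.
  rewrite -ii' in qi' qB' ne.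
  have ll' : l = l' by apply: val_inj; move: qi'; rewrite qi => /addnI.
  rewrite -ll' in qB' ne.
  have jj' : j != j' by apply: contra ne => /eqP->.
  by have /pred0P/(_ q)/= := B_disj i l jj'; rewrite qB qB'.
rewrite -(pair_bigA _ (fun x j => \sum_(q in B x.1 x.2 j)
  box_excess b q (greedy_corner b)))/=.
rewrite -(pair_bigA _ (fun i l => \sum_j \sum_(q in B i l j)
  box_excess b q (greedy_corner b)))/=.
apply: ler_sum => i _.
under eq_bigr => l _ do under eq_bigr => j _ do
  (under eq_bigr => q qB do rewrite (excess_on_core _ qB);
   rewrite -mulr_sumr -mulr_suml -sign_sum_dir_bits).
case E: (chosen_layer i b) => [l|]; last first.
  by rewrite mul0r big1// => l _; rewrite big1// => j _; rewrite mul0r.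
have gl : good_layer i l b.
  by move: E; rewrite /chosen_layer; case: pickP => // l' gl [<-].
rewrite (bigD1 l)//= [X in _ + X]big1 ?addr0 => [|l' ll']; last first.
  rewrite big1// => j _; rewrite (_ : (_ == _) = false) ?mul0r//.
  by apply/negbTE; apply: contra ll' => /eqP[->].
rewrite eqxx mul1r -[t in t%:R]card_ord -mulrA mulr_natl -sumr_const.
apply: ler_sum => j _; rewrite mul1r.
by move/forallP: gl => /(_ j); lra.
Qed.

Lemma avg_greedy_disc : (0 < L)%N -> (10 ^ t <= 10 * L)%N ->
  d%:R * (t%:R * Num.sqrt s%:R / 44) <=
  avg (fun b => bit_disc b (greedy_corner b)) :> R.
Proof.
move=> L0 tL; under eq_avg do rewrite bit_disc_excess//.
rewrite avg_sum (bigID (mem core))/= [X in _ + X]big1 ?addr0; last first.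
  by move=> q; apply: avg_excess_off_core.
rewrite -avg_sum; apply: le_trans (ler_avg sum_excess_on_core).
rewrite avg_sum -[d in d%:R]card_ord mulr_natl -sumr_const.
apply: ler_sum => i _.
rewrite (@eq_avg _ _ _ (fun b => (t%:R * Num.sqrt s%:R / 4) *
  (chosen_layer i b != None)%:R)) => [|b]; last by rewrite mulrC.
rewrite avgZ.
have : 0 <= t%:R * Num.sqrt s%:R / 4 :> R by rewrite !mulr_ge0 ?sqrtr_ge0.
have := avg_chosen_layer i L0 tL; nra.
Qed.

End GreedyBox.

(** * Choice of the blocks *)

Lemma exists_equal_blocks (T : finType) (A : {set T}) s t : (s * t <= #|A|)%N ->
  exists B : 'I_t -> {set T}, [/\ forall j, B j \subset A,
    forall j, #|B j| = s & forall j j', j != j' -> [disjoint B j & B j']].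
Proof.
move=> stA.
have idx_lt (j : 'I_t) (k : 'I_s) : (j * s + k < #|A|)%N.
  apply: leq_trans stA; apply: (@leq_trans (j.+1 * s)).
    by rewrite mulSn addnC ltn_add2r.
  by rewrite mulnC leq_mul2l ltn_ord orbT.
exists (fun j => [set enum_val (Ordinal (idx_lt j k)) | k : 'I_s]%SET); split.
- by move=> j; apply/fintype.subsetP => _ /imsetP[k _ ->]; exact: enum_valP.
- move=> j; rewrite card_imset ?card_ord// => k k' /enum_val_inj[/addnI].
  exact: val_inj.
- move=> j j' /negP jj'; apply/pred0P => x/=; apply/negP => /andP[].
  move=> /imsetP[k _ ->] /imsetP[k' _ /enum_val_inj[/(congr1 (divn^~ s))]].
  have s0 : (0 < s)%N by apply: leq_ltn_trans (ltn_ord k).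
  by rewrite !divnMDl// !divn_small// !addn0 => /val_inj/eqP.
Qed.

Lemma card_layer (m d M : nat) (i : 'I_d) (a : 'I_m) : (M <= m)%N ->
  #|[set q : {ffun 'I_d -> 'I_m} | (q i == a) &&
      [forall i', (i' != i) ==> (q i' < M)%N]]%SET| = (M ^ d.-1)%N.
Proof.
move=> Mm; pose F i' : pred 'I_m :=
  if i' == i then pred1 a else [pred x : 'I_m | x < M]%N.
rewrite (_ : #|_| = #|family F|); last first.
  apply: eq_card => q; rewrite inE.
  apply/andP/familyP => [[qi /forallP qlt] i'|h].
    rewrite /F; case: eqP => [->|/eqP i'i]; rewrite inE//.
    exact: (implyP (qlt i')).
  split; first by have := h i; rewrite /F eqxx inE.
  apply/forallP => i'; apply/implyP => /negbTE i'i.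
  by have := h i'; rewrite /F i'i inE.
rewrite card_family foldrE big_map big_enum/= (bigD1 i)//= /F eqxx card1 mul1n.
rewrite (eq_bigr (fun=> M)) => [|i' /negbTE ->].
  by rewrite prod_nat_const cardC1 card_ord.
have widen_inj : injective (widen_ord Mm) by move=> x y [/val_inj].
rewrite -[RHS](card_ord M) -(card_imset _ widen_inj).
apply: eq_card => x; rewrite inE; apply/idP/imsetP => [xM|[y _ ->]//=].
by exists (Ordinal xM) => //; apply: val_inj.
Qed.
Lemma greedy_corners_exist (R : rcfType) (m d L t s : nat) :
  (0 < L)%N -> (L <= m)%N -> (10 ^ t <= 10 * L)%N ->
  (s * t <= (m - L) ^ d.-1)%N ->
  exists c : {ffun {ffun 'I_d -> 'I_m} * 'I_d -> bool} -> 'I_d -> nat,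
    (forall b i, c b i < 2 * m)%N /\
    d%:R * (t%:R * Num.sqrt s%:R / 44) <= avg (fun b => bit_disc b (c b)) :> R.
Proof.
move=> L0 Lm tL stM; pose M := (m - L)%N.
have MLm : (M + L)%N = m by rewrite subnK.
have lay_lt (l : 'I_L) : (M + l < m)%N by rewrite -MLm ltn_add2l.
pose layer (i : 'I_d) l := [set q : {ffun 'I_d -> 'I_m} |
  (q i == Ordinal (lay_lt l)) && [forall i', (i' != i) ==> (q i' < M)%N]]%SET.
have blocks i l : exists B : 'I_t -> {set {ffun 'I_d -> 'I_m}},
    [/\ forall j, B j \subset layer i l,
    forall j, #|B j| = s & forall j j', j != j' -> [disjoint B j & B j']].
  by apply: exists_equal_blocks; rewrite card_layer// leq_subr.
have [B HB] := choice (fun il => blocks il.1 il.2).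
pose B3 i l := B (i, l).
have BL i l j q : q \in B3 i l j ->
    q i = (M + l)%N :> nat /\ forall i', i' != i -> (q i' < M)%N.
  have [/(_ j)/fintype.subsetP sub _ _] := HB (i, l).
  move=> /sub; rewrite inE => /andP[/eqP -> /forallP lt]; split => // i' i'i.
  exact: (implyP (lt i')).
have cB i l j : #|B3 i l j| = s by have [_ ->] := HB (i, l).
have dB i l j j' : j != j' -> [disjoint B3 i l j & B3 i l j'].
  by have [_ _] := HB (i, l); apply.
exists (@greedy_corner R m d L t M s B3); split.
  by move=> b i; exact: greedy_corner_lt.
exact: avg_greedy_disc.
Qed.

(** Taking [L] about [m / d] makes [M = m - L] at least [m (1 - 1 / d)], so that
    [M ^ (d - 1)] loses only a factor 4 against [m ^ (d - 1)]; and [L] is at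
    most [M], which leaves at least one cell for each of the [t] blocks. *)
Lemma jittered_bits_bound (R : realType) (m d : nat) :
  (2 <= m)%N -> (2 <= d)%N -> (d <= m)%N ->
  exists c : {ffun {ffun 'I_d -> 'I_m} * 'I_d -> bool} -> 'I_d -> nat,
    (forall b i, c b i < 2 * m)%N /\
    500^-1 * Num.sqrt (d%:R * m%:R ^+ d) *
      Num.sqrt ((1 + ln (m%:R / d%:R)) / (m%:R / d%:R))
    <= avg (fun b => bit_disc b (c b)) :> R.
Proof.
move=> m2 d2 dm.
pose L := (m %/ d)%N; pose M := (m - L)%N.
pose t := (trunc_log 10 L).+1; pose s := (M ^ d.-1 %/ t)%N.
have L0 : (0 < L)%N by rewrite divn_gt0//; lia.
have LdM : (L * d <= m)%N by exact: leq_divM.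
have LM : (L <= M)%N by rewrite /M; nia.
have tL : (10 ^ t <= 10 * L)%N by rewrite expnS leq_mul2l trunc_logP.
have Lt : (L < 10 ^ t)%N by exact: trunc_log_ltn.
have tM : (t <= M ^ d.-1)%N.
  apply: (@leq_trans M).
    apply: leq_trans LM; apply: (@leq_trans (10 ^ trunc_log 10 L)).
      exact: ltn_expl.
    exact: trunc_logP.
  by rewrite -[X in (X <= _)%N]expn1 leq_pexp2l//; lia.
have s0 : (0 < s)%N by rewrite divn_gt0.
have stM : (s * t <= M ^ d.-1)%N by exact: leq_divM.
have Mst : (M ^ d.-1 <= 2 * (s * t))%N.
  have : (M ^ d.-1 < s.+1 * t)%N by rewrite ltn_ceil.
  by nia.
have [c [cm cavg]] :=
  @greedy_corners_exist R m d L t s L0 (leq_div m d) tL stM.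
exists c; split => //; apply: le_trans cavg.
have d0 : 0 < d%:R :> R by rewrite ltr0n; lia.
have m0 : 0 < m%:R :> R by rewrite ltr0n; lia.
have M4 : m%:R ^+ d.-1 <= 4 * M%:R ^+ d.-1 :> R.
  have := @one_sub_inv_expr_ge R d.-1; rewrite prednK; last lia.
  have le1 : 1 - d%:R^-1 <= M%:R / m%:R :> R.
    rewrite ler_pdivlMr// mulrBl mul1r natrB ?leq_div// lerD2l lerN2.
    by rewrite mulrC ler_pdivlMr// -natrM ler_nat.
  have ge0 : 0 <= 1 - d%:R^-1 :> R.
    by rewrite subr_ge0 invf_le1// ler1n; lia.
  have : (1 - d%:R^-1) ^+ d.-1 <= (M%:R / m%:R) ^+ d.-1 :> R.
    by apply: lerXn2r; rewrite ?nnegrE// divr_ge0.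
  move=> h1 h2; have := le_trans h2 h1.
  by rewrite exprMn exprVn ler_pdivlMr ?exprn_gt0//; lra.
(* m / d is at most 2 * 10 ^ t and t >= 1, so 11 = 1 + 1 + 9 comes from the
   bounds ln 2 <= 1 and ln 10 <= 9. *)
have lnb : 1 + ln (m%:R / d%:R) <= 11 * t%:R :> R.
  have : m%:R / d%:R <= 2 * 10 ^+ t :> R.
    rewrite ler_pdivrMr// -natrX -!natrM ler_nat.
    have : (m < L.+1 * d)%N by rewrite ltn_ceil//; lia.
    have := Lt; move: (10 ^ t)%N => T; nia.
  rewrite -ler_ln ?posrE ?mulr_gt0 ?exprn_gt0 ?invr_gt0//.
  rewrite lnM ?posrE ?exprn_gt0// lnXn//.
  have l2 : ln 2 <= 1 :> R.
    by rewrite (_ : 2 = 1 + 1 :> R); [apply: le_ln1Dx|]; lra.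
  have l10 : ln 10 <= 9 :> R.
    by rewrite (_ : 10 = 1 + 9 :> R); [apply: le_ln1Dx|]; lra.
  have : 1 <= t%:R :> R by rewrite ler1n.
  by rewrite -mulr_natl; nra.
have ln0 : 0 <= ln (m%:R / d%:R) :> R.
  by rewrite ln_ge0// ler_pdivlMr// mul1r ler_nat.
have Mst' : M%:R ^+ d.-1 <= 2 * (s%:R * t%:R) :> R.
  by rewrite -natrX -!natrM ler_nat.
have le_of_sqr (x y : R) : 0 <= y -> x ^+ 2 <= y ^+ 2 -> x <= y.
  move=> y0; apply: contraTT; rewrite -!ltNge => yx.
  by rewrite ltr_pXn2r// nnegrE ltW// (le_lt_trans y0).
apply: le_of_sqr; first by rewrite !mulr_ge0 ?sqrtr_ge0.
rewrite !exprMn !sqr_sqrtr//; last by rewrite divr_ge0 ?divr_ge0// addr_ge0.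
rewrite -[X in m%:R ^+ X](@prednK d)//; last lia.
rewrite (exprS m%:R); set P := m%:R ^+ d.-1 in M4 *.
set l := 1 + _ in lnb *.
have -> : 500^-1 ^+ 2 * (d%:R * (m%:R * P)) * (l / (m%:R / d%:R)) =
    d%:R ^+ 2 * (P * l * 500^-1 ^+ 2).
  by field; rewrite !gt_eqF.
rewrite ler_pM2l ?exprn_gt0//.
(* P <= 8 s t and l <= 11 t; the constant is small enough because
   44 ^ 2 * 8 * 11 <= 500 ^ 2. *)
have : P * l <= (8 * (s%:R * t%:R)) * (11 * t%:R).
  apply: ler_pM => //; last lra.
  - by rewrite exprn_ge0.
  - by rewrite addr_ge0.
have : 0 <= s%:R * t%:R * t%:R :> R by rewrite !mulr_ge0.
set y := s%:R * t%:R * t%:R.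
have -> : 8 * (s%:R * t%:R) * (11 * t%:R) = 88 * y by rewrite /y; ring.
have -> : t%:R ^+ 2 * s%:R * 44^-1 ^+ 2 = y * 44^-1 ^+ 2 by rewrite /y; ring.
lra.
Qed.
(** * Lebesgue measure of boxes *)

Local Open Scope classical_set_scope.
Local Open Scope ring_scope.

Section Boxes.
Context {R : realType}.

Definition half_open_box d (a b : 'I_d -> R) : set (point R d) :=
  [set y | forall i, tnth y i \in `[a i, b i[].

Lemma measurable_half_open_box d (a b : 'I_d -> R) :
  measurable (half_open_box a b).
Proof.
have -> : half_open_box a b =
    \bigcap_(i in [set: 'I_d]) ((fun y : point R d => tnth y i) @^-1`
      [set` `[a i, b i[]).
  by apply/seteqP; split => [y ay i _|y ay i]; [exact: ay|exact: ay].
apply: fin_bigcap_measurable => // i _.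
rewrite -[X in measurable X]setTI; apply: measurable_tnth => //.
Qed.

Lemma lebesgue_point0 d : lebesgue_point (set0 : set (point R d)) = 0%E.
Proof.
elim: d => [|d IH]; first by rewrite /= /dirac indic0.
rewrite /= /pushforward preimage_set0 /product_measure1.
by rewrite integral0_eq// => x _ /=; rewrite xsection0.
Qed.

(** By Fubini in the first coordinate: the section of a box at [x] is the box in
    the other coordinates or empty, so the inner measure is an indicator times a
    constant. *)
Lemma lebesgue_point_box d (a b : 'I_d -> R) : (forall i, a i <= b i) ->
  lebesgue_point (half_open_box a b) = (\prod_i (b i - a i))%:E.
Proof.
elim: d => [|d IH] in a b *.
  by move=> _; rewrite big_ord0 /= diracE mem_set// => -[].
move=> ab; rewrite /= /pushforward /product_measure1.
set I0 := [set` `[a ord0, b ord0[] : set R.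
pose a' i := a (lift ord0 i); pose b' i := b (lift ord0 i).
have E x : lebesgue_point (xsection ((fun p : measurableTypeR R * point R d =>
    [tuple of p.1 :: p.2] : point R d.+1) @^-1` half_open_box a b) x) =
    ((\1_I0 x)%:E * (\prod_i (b' i - a' i))%:E)%E.
  rewrite -(IH a' b') => [|i]; last exact: ab.
  rewrite indicE; have [xI|xI] := boolP (x \in I0).
    rewrite mul1e; congr lebesgue_point.
    apply/seteqP; split => y; rewrite /xsection/= inE/= => yb.
      by move=> i; have := yb (lift ord0 i); rewrite tnthS.
    move=> i; have [j ->|->] := unliftP ord0 i.
      by rewrite tnthS; exact: yb.
    by rewrite tnth0; move: xI; rewrite inE.
  rewrite mul0e -(@lebesgue_point0 d); congr lebesgue_point.
  apply/seteqP; split => y //; rewrite /xsection/= inE/= => /(_ ord0).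
  by rewrite tnth0 => xI'; move: xI; rewrite notin_setE.
transitivity (\int[@lebesgue_measure R]_(x in [set: measurableTypeR R])
    ((\1_I0 x)%:E * (\prod_i (b' i - a' i))%:E))%E.
  by apply: eq_integral => x _; exact: E.
rewrite ge0_integralZr//; last 2 first.
- by apply/measurable_EFinP; apply: measurable_indic; exact: measurable_itv.
- by rewrite lee_fin; apply: prodr_ge0 => i _; rewrite subr_ge0; exact: ab.
rewrite integral_indic// ?setIT; last exact: measurable_itv.
rewrite [X in (X * _)%E](@lebesgue_measure_itv R `[a ord0, b ord0[)/=.
rewrite lte_fin big_ord_recl.
case: ltP => [_|ba]; first by rewrite -EFinB -EFinM.
have -> : b ord0 = a ord0 by apply/le_anti; rewrite ba ab.
by rewrite subrr mul0e mul0r.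
Qed.

End Boxes.

(** * Points in half-cells *)

Section BitsOfPoints.
Context {R : realType} {m d : nat}.
Hypothesis m0 : (0 < m)%N.
Local Notation cell := {ffun 'I_d -> 'I_m}.
Implicit Types (q : cell) (x : 'I_d -> bool) (c : 'I_d -> nat).

(** A point of the half-cell number [h] is compared with a multiple of
    [1 / (2 m)] as [h] is; in particular [h] is determined by the point. *)
Lemma grid_ltE (y : R) (h c : nat) :
  y \in `[h%:R / (2 * m)%:R, h.+1%:R / (2 * m)%:R[ ->
  (y < c%:R / (2 * m)%:R) = (h < c)%N.
Proof.
have k0 : 0 < (2 * m)%:R^-1 :> R by rewrite invr_gt0 ltr0n muln_gt0.
rewrite in_itv/= => /andP[hy yh]; case: (ltnP h c) => [hc|ch].
  by rewrite (lt_le_trans yh)// ler_pM2r// ler_nat.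
by apply/negbTE; rewrite -leNgt (le_trans _ hy)// ler_pM2r// ler_nat.
Qed.

Definition half_cell q x : set (point R d) :=
  half_open_box (fun i => (2 * q i + ~~ x i)%:R / (2 * m)%:R)
                (fun i => (2 * q i + ~~ x i).+1%:R / (2 * m)%:R).

Definition grid_point c : point R d := [tuple (c i)%:R / (2 * m)%:R | i < d].

Lemma half_cell_in_box (y : point R d) q x c : half_cell q x y ->
  anchored_box (grid_point c) y <-> forall i, (2 * q i + ~~ x i < c i)%N.
Proof.
move=> yq; have k0 : 0 < (2 * m)%:R^-1 :> R by rewrite invr_gt0 ltr0n muln_gt0.
split => [yc i|yc i]; have := yq i => yi.
  have := yc i; rewrite in_itv/= tnth_mktuple => /andP[_].
  by rewrite (grid_ltE _ yi).
rewrite in_itv/= tnth_mktuple (grid_ltE _ yi) yc andbT.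
by move: yi; rewrite in_itv/= => /andP[+ _]; apply: le_trans; rewrite divr_ge0.
Qed.

Lemma half_cell_inj (y : point R d) q x q' x' :
  half_cell q x y -> half_cell q' x' y -> q = q' /\ x =1 x'.
Proof.
move=> yq yq'.
have E i : (2 * q i + ~~ x i)%N = (2 * q' i + ~~ x' i)%N.
  have E k := etrans (esym (grid_ltE k (yq i))) (grid_ltE k (yq' i)).
  by have := E (2 * q i + ~~ x i).+1; have := E (2 * q' i + ~~ x' i).+1; lia.
split; first apply/ffunP => i; last move=> i.
  by apply: val_inj => /=; have := E i; lia.
by have := E i; case: (x i); case: (x' i) => //=; lia.
Qed.

Lemma half_cell_sub_mcube q x : half_cell q x `<=` mcube q.
Proof.
move=> y yq i; have := yq i; rewrite !in_itv/= => /andP[].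
have m0' : 0 < m%:R :> R by rewrite ltr0n.
rewrite ler_pdivrMr ?ltr_pdivlMr ?ltr0n ?muln_gt0// => h1 h2.
rewrite ler_pdivrMr// -[X in _ + X]mul1r -mulrDl ltr_pdivlMr//.
have : (2 * q i + ~~ x i).+1%:R <= 2 * (q i)%:R + 2 :> R.
  by rewrite -natrM -natrD ler_nat; lia.
have : 2 * (q i)%:R <= (2 * q i + ~~ x i)%:R :> R.
  by rewrite -natrM ler_nat leq_addr.
by move: h1 h2; rewrite natrM; lra.
Qed.

Lemma lebesgue_half_cell q x :
  lebesgue_point (half_cell q x) = ((2 * m)%:R^-1 ^+ d)%:E :> \bar R.
Proof.
rewrite lebesgue_point_box => [|i].
  rewrite -[in RHS](card_ord d) -prodr_const; congr _%:E.
  by apply: eq_bigr => i _; rewrite -mulrBl -natr1 addrC addKr mul1r.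
by rewrite ler_pM2r ?invr_gt0 ?ltr0n ?muln_gt0// ler_nat.
Qed.

Lemma lebesgue_mcube q : lebesgue_point (mcube q) = (m%:R^-1 ^+ d)%:E :> \bar R.
Proof.
rewrite (@lebesgue_point_box _ _ (fun i => (q i)%:R / m%:R)
  (fun i => (q i)%:R / m%:R + m%:R^-1)) => [|i].
  rewrite -[in RHS](card_ord d) -prodr_const; congr _%:E.
  by apply: eq_bigr => i _; rewrite addrC addKr.
by rewrite lerDl invr_ge0.
Qed.

(** The half-cells are disjoint, so points chosen in half-cells of different
    cells are distinct and the box contains as many of them as its indicator
    counts cells. *)
Lemma disc_bit_disc (f : cell -> point R d) (b : {ffun cell * 'I_d -> bool}) c :
  (forall q, half_cell q (fun i => b (q, i)) (f q)) ->
  disc (range f) (anchored_box (grid_point c)) = bit_disc b c.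
Proof.
move=> fb; have f_inj : injective f.
  move=> q q' ff'; have := fb q; rewrite ff' => h.
  by have [] := half_cell_inj h (fb q').
have count (A : set (point R d)) (p : pred cell) :
    (forall q, A (f q) <-> p q) -> #|` fset_set (range f `&` A)| = #|p|.
  move=> Ap; have -> : range f `&` A = f @` [set q | p q].
    apply/seteqP; split => [_ [[q _ <-] /Ap pq]|_ [q /Ap Aq <-]].
      by exists q.
    by split.
  have fin : finite_set [set q | p q] by exact: finite_finset.
  rewrite fset_set_image// card_imfset//= cardE; apply: perm_size.
  apply: uniq_perm; [exact: fset_uniq|exact: enum_uniq|] => q.
  by rewrite mem_enum in_fset_set// mem_setE.
rewrite /disc /bit_disc; congr (_ - _).
  rewrite (count _ (fun q => in_box b q c)) => [|q].
    rewrite -sum1_card natr_sum big_mkcond/=.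
    by apply: eq_bigr => q _; rewrite /in_mem/=; case: in_box.
  rewrite (half_cell_in_box _ (fb q)); split => [h|/forallP//].
  exact/forallP.
have := count setT xpredT; rewrite setIT => ->//.
rewrite card_ffun !card_ord (@lebesgue_point_box _ _ (fun=> 0)) => [|i].
  rewrite /= natrX -[in m%:R ^+ _](card_ord d) -prodr_const -big_split/=.
  apply: eq_bigr => i _; rewrite tnth_mktuple subr0 natrM; field.
  by rewrite pnatr_eq0 -lt0n.
by rewrite tnth_mktuple mulr_ge0.
Qed.

End BitsOfPoints.

(** * From the bits to the expected star discrepancy *)

Section StarDiscrepancyBounds.
Context {R : realType} {d : nat}.
Implicit Types (P A : set (point R d)) (x : point R d).

(** A finite set and a box of volume at most 1 have discrepancy at most twice
    the number of points, so the supremum is that of a bounded set. *)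
Lemma star_discrepancy_ge P x : finite_set P -> unit_cube x ->
  `|disc P (anchored_box x)| <= star_discrepancy P.
Proof.
move=> finP xU; apply: ub_le_sup; last by exists x.
exists (#|` fset_set P|%:R + #|` fset_set P|%:R) => _ [z zU <-].
have z01 i : 0 <= tnth z i <= 1.
  by have := zU i; rewrite in_itv/= => /andP[-> /ltW].
rewrite /disc (@lebesgue_point_box _ _ (fun=> 0)) => [|i]; last first.
  by case/andP: (z01 i).
apply: le_trans (ler_normB _ _) _; rewrite lerD//.
  rewrite ger0_norm// ler_nat; apply: fsubset_leq_card.
  by rewrite -fset_set_sub//; last by apply: sub_finite_set finP => y [].
rewrite normrM ger0_norm// ler_piMr//= ger0_norm; last first.
  by apply: prodr_ge0 => i _; rewrite subr0; case/andP: (z01 i).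
by apply: prodr_ile1 => i _; rewrite subr0.
Qed.

Lemma star_discrepancy_ge0 P : finite_set P -> 0 <= star_discrepancy P.
Proof.
move=> finP; pose x : point R d := [tuple 0 | i < d].
apply: le_trans (normr_ge0 (disc P (anchored_box x))) _.
by apply: star_discrepancy_ge => // i; rewrite tnth_mktuple in_itv/= lexx/=.
Qed.

End StarDiscrepancyBounds.

(** Only the minorant needs to be measurable: for a nonnegative integrand the
    integral is a supremum over the simple functions below it. *)
Lemma ge0_integral_mono {R : realType} {disp : measure_display}
  {T : measurableType disp} (mu : {measure set T -> \bar R})
  (f g : T -> \bar R) : (forall w, 0 <= g w)%E -> (forall w, g w <= f w)%E ->
  (\int[mu]_w g w <= \int[mu]_w f w)%E.
Proof.
move=> g0 gf; rewrite !ge0_integralTE// => [|w]; last exact: le_trans (gf w).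
by apply: ereal_sup_le => _ [h hg <-]; exists h => // w; apply: le_trans (gf w).
Qed.

Section LawOfBits.
Context {R : realType} {disp : measure_display} {T : measurableType disp}.
Context (Pr : probability T R) {m d : nat}.
Hypothesis m0 : (0 < m)%N.
Local Notation cell := {ffun 'I_d -> 'I_m}.
Local Notation bits := {ffun cell * 'I_d -> bool}.
Variable X : cell -> {RV Pr >-> point R d}.
Hypothesis jX : jittered_sampling X.

(** These events exclude the samples that have a point outside its cell, which
    form a null set. *)
Definition bits_event (b : bits) : set T :=
  \bigcap_(q in [set: cell]) (X q @^-1` half_cell q (fun i => b (q, i))).

Lemma measurable_half_cell (q : cell) (x : 'I_d -> bool) :
  measurable (half_cell q x : set (point R d)).
Proof. exact: measurable_half_open_box. Qed.

Lemma measurable_bits_event b : measurable (bits_event b).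
Proof.
apply: fin_bigcap_measurable => // q _; rewrite -[X in measurable X]setTI.
by apply: measurable_funP => //; exact: measurable_half_cell.
Qed.

Lemma bits_event_disjoint b b' w : bits_event b w -> bits_event b' w -> b = b'.
Proof.
move=> bw b'w; apply/ffunP => -[q i].
by have [_ /(_ i)] := half_cell_inj m0 (bw q Logic.I) (b'w q Logic.I).
Qed.

Lemma pr_half_cell (q : cell) (x : 'I_d -> bool) :
  Pr (X q @^-1` half_cell q x) = ((2^-1) ^+ d)%:E.
Proof.
have [_ /(_ q (half_cell q x) (measurable_half_cell q x))] := jX.
rewrite /distribution /pushforward => ->.
rewrite setIidl; last exact: half_cell_sub_mcube.
rewrite lebesgue_half_cell// lebesgue_mcube inver ifF; last first.
  by apply/negbTE; rewrite expf_neq0// invr_neq0// pnatr_eq0 -lt0n.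
rewrite -EFinM natrM invfM exprMn mulfK//.
by rewrite expf_neq0// invr_neq0// pnatr_eq0 -lt0n.
Qed.

Lemma pr_bits_event b : Pr (bits_event b) = ((2 ^+ #|{: cell * 'I_d}|)^-1)%:E.
Proof.
have [/(_ [set: cell]%SET (fun q => half_cell q (fun i => b (q, i)))) ind _] :=
  jX.
rewrite /bits_event -[X in \bigcap_(q in X) _](_ : [set` [set: cell]%SET] = _).
  rewrite ind => [|q]; last exact: measurable_half_cell.
  under eq_bigr do rewrite pr_half_cell.
  rewrite prodEFin prodr_const cardsT card_prod card_ord -exprM mulnC exprVn.
  by [].
by apply/seteqP; split => q //= _; rewrite inE.
Qed.

(** The star discrepancy is bounded below by the simple function that equals the
    absolute discrepancy of the box [c b] on the event of the bits [b]. *)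
Lemma expectation_star_discrepancy_ge (c : bits -> 'I_d -> nat) :
  (forall b i, c b i < 2 * m)%N ->
  ((avg (fun b => bit_disc b (c b)))%:E <=
    'E_Pr[fun w => star_discrepancy (sample_set X w)])%E.
Proof.
move=> cm; have fin w : finite_set (sample_set X w).
  by apply: finite_image; exact: finite_finset.
pose g w := (\sum_b `|bit_disc b (c b) : R|%:E * (\1_(bits_event b) w)%:E)%E.
rewrite unlock; apply: (@le_trans _ _ (\int[Pr]_w g w)%E); last first.
  apply: ge0_integral_mono => w.
    by apply: sume_ge0 => b _; rewrite mule_ge0// lee_fin.
  have [[b bw]|nb] := pselect (exists b, bits_event b w); last first.
    rewrite /g big1 ?lee_fin ?star_discrepancy_ge0// => b _.
    by rewrite indicE memNset ?mule0// => bw; apply: nb; exists b.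
  rewrite /g (bigD1 b)//= big1 ?adde0 => [|b' b'b]; last first.
    rewrite indicE memNset ?mule0// => b'w.
    by move/eqP: b'b; apply; exact: bits_event_disjoint b'w bw.
  rewrite indicE mem_set// mule1 lee_fin.
  rewrite -(@disc_bit_disc R m d m0 (fun q => X q w)).
  2: by move=> q; exact: bw.
  apply: star_discrepancy_ge; [exact: fin|move=> i].
  rewrite tnth_mktuple in_itv/= divr_ge0//= ltr_pdivrMr ?ltr0n ?muln_gt0//.
  by rewrite mul1r ltr_nat.
rewrite /g ge0_integral_sum//; last first.
  move=> b; apply: emeasurable_funM => //.
  apply/measurable_EFinP; apply: measurable_indic.
  exact: measurable_bits_event.
rewrite /avg mulr_suml -sumEFin; apply: lee_sum => b _.
rewrite ge0_integralZl//; last first.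
  apply/measurable_EFinP; apply: measurable_indic.
  exact: measurable_bits_event.
rewrite integral_indic//; last exact: measurable_bits_event.
rewrite setIT [X in (_ * X)%E](pr_bits_event b) -EFinM lee_fin.
by rewrite ler_pM2r ?ler_norm.
Qed.

End LawOfBits.

Theorem theorem2 (R : realType) :
  exists2 C : R, 0 < C &
    forall m d : nat, (2 <= m)%N -> (2 <= d)%N -> (d <= m)%N ->
    forall (disp : measure_display) (T : measurableType disp)
      (Pr : probability T R)
      (X : {ffun 'I_d -> 'I_m} -> {RV Pr >-> point R d}),
    jittered_sampling X ->
    ((C * Num.sqrt (d%:R * m%:R ^+ d) *
      Num.sqrt ((1 + ln (m%:R / d%:R)) / (m%:R / d%:R)))%:E
     <= 'E_Pr[fun w => star_discrepancy (sample_set X w)])%E.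
Proof.
exists 500^-1; first by rewrite invr_gt0 ltr0n.
move=> m d m2 d2 dm disp T Pr X jX.
have [c [cm cavg]] := @jittered_bits_bound R m d m2 d2 dm.
have m0 : (0 < m)%N by lia.
by apply: le_trans (expectation_star_discrepancy_ge m0 jX cm); rewrite lee_fin.
Qed.
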